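(* Let $P\bowtie G$ be a Zappa-Szép product of a semigroup $P$ and a group $G$, let $\mathcal{A}$ be a unital C*-algebra, let $X$ be a product system over $P$ with coefficient $\mathcal{A}$, and let $(X,G,\beta)$ be a Zappa-Szép system. Then $\mathcal{O}_{X\bowtie G}\cong\mathcal{O}_X\bowtie G$ ($*$-isomorphism of C*-algebras).
   Context: Semigroups and groups are discrete, and every semigroup has an identity, written $e$ (the identity of $G$ is also written $e$). Zappa-Szép product. One is given a left action $G\times P\to P$, $(g,p)\mapsto g\cdot p$, and a map $P\times G\to G$, $(p,g)\mapsto g|_p$, such that for all $g,h\in G$, $p,q\in P$: $e\cdot p=p$; $(gh)\cdot p=g\cdot(h\cdot p)$; $g\cdot e=e$; $g|_e=g$; $g\cdot(pq)=(g\cdot p)(g|_p\cdot q)$; $g|_{pq}=(g|_p)|_q$; $e|_p=e$; $(gh)|_p=g|_{h\cdot p}\,h|_p$. Then $P\bowtie G=P\times G$ with product $(p,g)(q,h)=(p(g\cdot q),\,g|_q h)$ is a semigroup with identity $(e,e)$. Product system. An $\mathcal{A}$-correspondence is a right Hilbert $\mathcal{A}$-module with a left action of $\mathcal{A}$ by adjointable operators. A product system over a semigroup $P$ with coefficient $\mathcal{A}$ is $X=\bigsqcup_{p\in P}X_p$, with each $X_p$ an $\mathcal{A}$-correspondence, with an associative multiplication $X_p\times X_q\to X_{pq}$ such that (1) $X_e=\mathcal{A}$ as an $\mathcal{A}$-correspondence; (2) for all $p,q\in P$ the multiplication extends to a unitary $M_{p,q}:X_p\otimes X_q\to X_{pq}$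 (interior tensor product over $\mathcal{A}$); (3) the left and right actions of $\mathcal{A}$ on $X_p$ coincide with the multiplications $X_e\times X_p\to X_p$ and $X_p\times X_e\to X_p$. Zappa-Szép action of $G$ on $X$: a collection $\beta=\{\beta_g\}_{g\in G}$ of maps on $X$ such that (A1) for each $p\in P$, $g\in G$, $\beta_g$ restricts to a $\mathbb{C}$-linear map $X_p\to X_{g\cdot p}$; (A2) $\beta_g\circ\beta_h=\beta_{gh}$; (A3) $\beta_e$ is the identity; (A4) each $\beta_g$ is a $*$-automorphism of $X_e=\mathcal{A}$; (A5) $\beta_g(xy)=\beta_g(x)\beta_{g|_p}(y)$ for $x\in X_p$, $y\in X_q$; (A6) $\langle\beta_g(x),\beta_g(y)\rangle=\beta_{g|_p}(\langle x,y\rangle)$ for $x,y\in X_p$. The triple $(X,G,\beta)$ is then called a Zappa-Szép system. The product system $X\bowtie G$ over $P\bowtie G$ with coefficient $\mathcal{A}$: its fibre over $(p,g)$ is $Y_{(p,g)}=\{x\otimes g:x\in X_p\}$ with $a(x\otimes g)=ax\otimes g$, $(x\otimes g)a=x\beta_g(a)\otimes g$, $\langle x\otimes g,y\otimes g\rangle=\beta_{g^{-1}}(\langle x,y\rangle)$, and multiplication $(x\otimes g)(y\otimes h)=x\beta_g(y)\otimes g|_q h$ for $x\in X_p$, $y\in X_q$; $Y_{(e,e)}$ is identified with $\mathcal{A}$ via $a\otimes e\leftrightarrow a$. A (Toeplitz) representation of a product system $X$ over $P$ on a C*-algebra $\mathcal{B}$ is a family $\psi=(\psi_p)_{p\in P}$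 of linear maps $\psi_p:X_p\to\mathcal{B}$ such that $\psi_e$ is a $*$-homomorphism, $\psi_p(x)\psi_q(y)=\psi_{pq}(xy)$ for $x\in X_p,y\in X_q$, and $\psi_p(x)^*\psi_p(y)=\psi_e(\langle x,y\rangle)$ for $x,y\in X_p$. Cuntz-Pimsner covariance. $\mathcal{L}(X_p)$ is the C*-algebra of adjointable operators, $\theta_{x,y}(z)=x\langle y,z\rangle$, and $\mathcal{K}(X_p)$ is the C*-subalgebra generated by the $\theta_{x,y}$, $x,y\in X_p$. A representation $\psi$ induces homomorphisms $\psi^{(p)}:\mathcal{K}(X_p)\to\mathcal{B}$ with $\psi^{(p)}(\theta_{x,y})=\psi_p(x)\psi_p(y)^*$. Let $\phi_p:X_e\to\mathcal{L}(X_p)$, $\phi_p(a)x=a\cdot x$. The representation $\psi$ is Cuntz-Pimsner covariant if $\psi^{(p)}(\phi_p(a))=\psi_e(a)$ for all $p\in P$ and all $a\in X_e$ with $\phi_p(a)\in\mathcal{K}(X_p)$. $\mathcal{O}_X$ denotes the universal C*-algebra for Cuntz-Pimsner covariant representations of $X$: it is generated by the image of a universal Cuntz-Pimsner covariant representation $j_X$, and every Cuntz-Pimsner covariant representation $\psi$ factors as $\psi=\psi_*\circ j_X$ for a $*$-homomorphism $\psi_*:\mathcal{O}_X\to C^*(\psi(X))$. A covariant representation of $(X,G,\beta)$ on a unital C*-algebra $\mathcal{B}$ is a pair $(\psi,U)$ of a representation $\psi$ of $X$ on $\mathcal{B}$ and a unitary representation $U$ of $G$ on $\mathcal{B}$ with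 $U_g\psi_p(x)=\psi_{g\cdot p}(\beta_g(x))U_{g|_p}$ for all $p\in P$, $g\in G$, $x\in X_p$. $\mathcal{O}_X\bowtie G$ denotes the universal C*-algebra generated by the set of all covariant representations $(\psi,U)$ of $(X,G,\beta)$ with $\psi$ Cuntz-Pimsner covariant.
   Formalization: In the definition of a covariant representation (ψ,U) on a unital C*-algebra, ψ is additionally required to be unital, ψ_e(1)=1; without this the claim fails already for trivial P and G with A=ℂ, where O_X⋈G would be ℂ² but O_{X⋈G}=ℂ. *)

(* Defs.v *)
From HB Require Import structures.
From mathcomp Require Import all_boot all_order all_algebra.
From mathcomp Require Import complex.
From mathcomp Require Import all_classical all_reals topology normedtype sequences.
Set Implicit Arguments. Unset Strict Implicit. Unset Printing Implicit Defensive.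
Import Order.TTheory GRing.Theory Num.Theory.
Import numFieldNormedType.Exports.
Local Open Scope classical_set_scope.
Local Open Scope ring_scope.

(* A C*-algebra need not have a unit, so its product is not the one of a
   MathComp ring.  The norm takes its values in R[i], as for every normed module
   over R[i]; completeness is that of [completeNormedModType]. *)
HB.mixin Record isCStarAlgebra (R : realType) B of CompleteNormedModule R[i] B := {
  cmul : B -> B -> B;
  star : B -> B;
  cmulA : associative cmul;
  cmulDl : left_distributive cmul +%R;
  cmulDr : right_distributive cmul +%R;
  cmulZl : forall (c : R[i]) x y, cmul (c *: x) y = c *: cmul x y;
  cmulZr : forall (c : R[i]) x y, cmul x (c *: y) = c *: cmul x y;
  starK : involutive star;
  starD : {morph star : x y / x + y};
  starZ : forall (c : R[i]) x, star (c *: x) = c^* *: star x;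
  starM : forall x y, star (cmul x y) = cmul (star y) (star x);
  cnormM : forall x y : B, `|cmul x y| <= `|x| * `|y|;
  cnorm_star : forall x : B, `|cmul (star x) x| = `|x| ^+ 2
}.

#[short(type="cstarAlgType")]
HB.structure Definition CStarAlgebra (R : realType) :=
  {B of isCStarAlgebra R B & CompleteNormedModule R[i] B}.

HB.mixin Record CStarAlgebra_isUnital (R : realType) B of CStarAlgebra R B := {
  cone : B;
  cmul1x : left_id cone (@cmul R B);
  cmulx1 : right_id cone (@cmul R B)
}.

#[short(type="ucstarAlgType")]
HB.structure Definition UnitalCStarAlgebra (R : realType) :=
  {B of CStarAlgebra_isUnital R B & CStarAlgebra R B}.

Notation "x ** y" := (cmul x y) (at level 40, left associativity) : ring_scope.

Definition star_hom (R : realType) (A B : cstarAlgType R) (f : A -> B) : Prop :=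
  [/\ linear f, {morph f : x y / x ** y} & {morph f : x / star x}].

Definition star_isomorphic (R : realType) (A B : cstarAlgType R) : Prop :=
  exists f : A -> B, star_hom f /\ bijective f.


Section CStarTheory.
Variables (R : realType) (A : cstarAlgType R).
Implicit Types (x y z : A) (c : R[i]).

Lemma cmul0x y : 0 ** y = 0.
Proof. by apply: (addIr (0 ** y)); rewrite -cmulDl !add0r. Qed.

Lemma cmulx0 y : y ** 0 = 0.
Proof. by apply: (addIr (y ** 0)); rewrite -cmulDr !add0r. Qed.

Lemma cmulNx x y : (- x) ** y = - (x ** y).
Proof. by rewrite -scaleN1r cmulZl scaleN1r. Qed.

Lemma cmulxN x y : x ** (- y) = - (x ** y).
Proof. by rewrite -scaleN1r cmulZr scaleN1r. Qed.

Lemma cmulBl x y z : (x - y) ** z = x ** z - y ** z.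
Proof. by rewrite cmulDl cmulNx. Qed.

Lemma cmulBr x y z : z ** (x - y) = z ** x - z ** y.
Proof. by rewrite cmulDr cmulxN. Qed.

Lemma star0 : star 0 = 0 :> A.
Proof. by apply: (addIr (star 0)); rewrite -starD !add0r. Qed.

Lemma starN x : star (- x) = - star x.
Proof. by rewrite -scaleN1r starZ rmorphN rmorph1 scaleN1r. Qed.

Lemma starB x y : star (x - y) = star x - star y.
Proof. by rewrite starD starN. Qed.

Lemma norm_star x : `|star x| = `|x|.
Proof.
have le z : `|z| <= `|star z|.
  have [->|z0] := eqVneq z 0; first by rewrite normr0.
  rewrite -(ler_pM2r (_ : 0 < `|z|)) ?normr_gt0// -expr2 -cnorm_star.
  exact: cnormM.
by apply/eqP; rewrite eq_le le andbT -{2}(starK x) le.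
Qed.

Lemma star_hom0 (B : cstarAlgType R) (f : A -> B) : star_hom f -> f 0 = 0.
Proof. by case=> lf _ _; have := lf (-1) 0 0; rewrite scaler0 addr0 scaleN1r addNr. Qed.

Lemma star_homD (B : cstarAlgType R) (f : A -> B) : star_hom f ->
  {morph f : x y / x + y}.
Proof. by case=> lf _ _ x y; have := lf 1 x y; rewrite !scale1r. Qed.

Lemma star_homZ (B : cstarAlgType R) (f : A -> B) : star_hom f ->
  forall c x, f (c *: x) = c *: f x.
Proof. by move=> hf; case: (hf) => lf _ _ c x; have := lf c x 0; rewrite !addr0 (star_hom0 hf) addr0. Qed.

Lemma eps0 x c : 0 <= c -> (forall e, 0 < e -> `|x| <= c * e) -> x = 0.
Proof.
move=> c0 h; apply/eqP; apply: contraT => x0.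
have nx : 0 < `|x| by rewrite normr_gt0.
have d : 0 < c + 1 by rewrite ltr_wpDl.
have := h (`|x| / (c + 1)) (divr_gt0 nx d).
rewrite mulrCA -ler_pdivrMl// mulVf ?gt_eqF// ler_pdivlMr// mul1r.
by rewrite gerDl lt_geF.
Qed.

End CStarTheory.

(* Automorphisms of a unital C*-algebra are isometric; this is what makes the
   fibres x (x) g of the bowtie product system complete.  For h self-adjoint with
   |h| < 1, the element k below makes f h + 'i f k a unitary with real part f h. *)
Section SquareRoot.
Variables (R : realType) (A : ucstarAlgType R) (h : A).
Hypotheses (hs : star h = h) (h1 : `|h| < 1).

Let s := `|h|.
Let half : R[i] := 2^-1.
Let F (y : A) := half *: (h ** h + y ** y).
Let y n := iter n F 0.

Let s_ge0 : 0 <= s. Proof. exact: normr_ge0. Qed.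
Let s_le1 : s <= 1. Proof. exact: ltW. Qed.
Let half_ge0 : 0 <= half. Proof. by rewrite invr_ge0. Qed.
Let nhalf : `|half| = half. Proof. by rewrite ger0_norm. Qed.
Let halfD (x : R[i]) : half * (x + x) = x.
Proof. by rewrite /half -mulr2n -[x *+ 2]mulr_natl mulKf// pnatr_eq0. Qed.

Let y_le n : `|y n| <= s.
Proof.
elim: n => [|n ih]; first by rewrite normr0.
rewrite /= normrZ nhalf -[leRHS]halfD ler_wpM2l//.
rewrite (le_trans (ler_normD _ _))// lerD//.
  by rewrite (le_trans (cnormM _ _))// ler_piMr.
by rewrite (le_trans (cnormM _ _))// (le_trans (ler_pM _ _ ih ih))// ler_piMr.
Qed.

Let y_star n : star (y n) = y n.
Proof.
elim: n => [|n ih]; first exact: star0.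
rewrite /= starZ starD !starM hs -/(y n) ih; congr (_ *: _).
by rewrite /half -[RHS]conj_Creal// ger0_real.
Qed.

Let y_comm n : y n ** h = h ** y n.
Proof.
elim: n => [|n ih]; first by rewrite cmul0x cmulx0.
rewrite /= cmulZl cmulZr cmulDl cmulDr cmulA -/(y n); congr (_ *: (_ + _)).
by rewrite -cmulA ih cmulA ih cmulA.
Qed.

Let sqB (a b : A) : a ** a - b ** b = a ** (a - b) + (a - b) ** b.
Proof. by rewrite cmulBr cmulBl addrA subrK. Qed.

Let y_step n : `|y n.+1 - y n| <= s ^+ n.+1.
Proof.
elim: n => [|n ih]; first by rewrite subr0 expr1; exact: (y_le 1).
rewrite {1}[y n.+2]/(F (y n.+1)) {2}[y n.+1]/(F (y n)) /F -scalerBr.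
rewrite opprD addrACA subrr add0r sqB normrZ nhalf -[leRHS]halfD ler_wpM2l//.
rewrite (le_trans (ler_normD _ _))// lerD// (le_trans (cnormM _ _))//.
  by rewrite exprS ler_pM.
by rewrite exprSr ler_pM.
Qed.

Let y_dist n m : (1 - s) * `|y (n + m)%N - y n| <= s ^+ n.+1 * (1 - s ^+ m).
Proof.
elim: m => [|m ih]; first by rewrite addn0 !subrr normr0 !mulr0.
have s1 : 0 <= 1 - s by rewrite subr_ge0.
have := lerD ih (ler_wpM2l s1 (y_step (n + m)%N)).
rewrite -mulrDr => le; rewrite addnS.
apply: le_trans (le_trans _ le) _.
  by rewrite ler_wpM2l// [leRHS]addrC ler_distD.
rewrite -addSn exprD mulrCA -mulrDr mulrBl mul1r -exprS addrA subrK.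
by rewrite lexx.
Qed.

Let s_small (e : R[i]) : 0 < e -> exists N, s ^+ N < e.
Proof.
move=> e0; have sR : s = (complex.Re s)%:C%C by rewrite RRe_real ?ger0_real.
have eR : e = (complex.Re e)%:C%C by rewrite RRe_real ?gtr0_real.
have e0' : 0 < complex.Re e by rewrite -ltcR -eR.
have s1' : `|complex.Re s| < 1.
  rewrite ger0_norm -?lecR -?ltcR -?sR//.
have /cvgrPdist_lt/(_ _ e0')[N _ /(_ N (leqnn N)) /=] := cvg_expr s1'.
rewrite sub0r normrN => lN; exists N.
rewrite eR sR -rmorphXn ltcR (le_lt_trans (ler_norm _))//.
Qed.

Let y_lim : exists l : A, forall e : R[i], 0 < e ->
  exists N, `|l - y N| < e /\ `|l - y N.+1| < e.
Proof.
have s1 : 0 < 1 - s by rewrite subr_gt0.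
have cy : cvg (y @ \oo).
  apply: cauchy_cvg; apply: cauchy_exP => e e0.
  have [N Ns] := s_small (mulr_gt0 s1 e0).
  exists (y N); exists N => // n /= Nn; rewrite -ball_normE /= distrC.
  rewrite -(ltr_pM2l s1) -(subnKC Nn) (le_lt_trans (y_dist _ _))//.
  rewrite (le_lt_trans _ Ns)// exprSr -mulrA ler_piMr ?exprn_ge0//.
  rewrite mulr_ile1// ?subr_ge0 ?exprn_ile1// lerBlDl.
  by rewrite lerDr exprn_ge0.
exists (lim (y @ \oo)) => e e0.
have /cvgrPdist_lt/(_ _ e0)[N _ hN] := cy.
by exists N; split; apply: hN => //=.
Qed.

Lemma sqrt_exists : exists k : A,
  [/\ star k = k, k ** h = h ** k & h ** h + k ** k = cone].
Proof.
have [l hl] := y_lim; exists (cone - l).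
have ls : star l = l.
  apply/eqP; rewrite -subr_eq0; apply/eqP; apply: (@eps0 _ _ _ 2) => // e e0.
  have [N [lN _]] := hl _ e0.
  rewrite (le_trans (ler_distD (y N) _ _))// -{1}(y_star N) -starB norm_star.
  by rewrite mulr_natl mulr2n lerD ?ltW// distrC.
have one_s : star cone = cone :> A.
  by rewrite -[LHS]cmulx1 -{2}(starK cone) -starM cmulx1 starK.
have lh : l ** h = h ** l.
  apply/eqP; rewrite -subr_eq0; apply/eqP; apply: (@eps0 _ _ _ (s + s)).
    by rewrite addr_ge0.
  move=> e e0; have [N [lN _]] := hl _ e0.
  have -> : l ** h - h ** l = (l - y N) ** h + h ** (y N - l).
    by rewrite cmulBl cmulBr y_comm addrA subrK.
  rewrite (le_trans (ler_normD _ _))// mulrDl lerD// (le_trans (cnormM _ _))//.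
    by rewrite mulrC ler_wpM2l// ltW.
  by rewrite ler_wpM2l// distrC ltW.
have fl : l = F l.
  apply/eqP; rewrite -subr_eq0; apply/eqP.
  apply: (@eps0 _ _ _ (1 + half * (`|l| + s))).
    by rewrite addr_ge0// mulr_ge0// addr_ge0.
  move=> e e0; have [N [lN lN1]] := hl _ e0.
  rewrite (le_trans (ler_distD (y N.+1) _ _))//.
  rewrite mulrDl mul1r lerD//; first exact: ltW.
  rewrite [y N.+1]/(F (y N)) /F -scalerBr opprD addrACA subrr add0r sqB.
  rewrite normrZ nhalf -mulrA ler_wpM2l// (le_trans (ler_normD _ _))//.
  rewrite addrC mulrDl lerD// (le_trans (cnormM _ _))//.
    by rewrite mulrC ler_wpM2l// distrC ltW.
  by rewrite ler_pM// distrC ltW.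
split.
- by rewrite starB one_s ls.
- by rewrite cmulBl cmulBr lh cmul1x cmulx1.
- have e2 : h ** h + l ** l = l + l.
    rewrite {3 4}fl /F -scalerDl /half -mulr2n -[_ *+ 2]mulr_natl mulfV ?scale1r//.
    by rewrite pnatr_eq0.
  have -> : (cone - l) ** (cone - l) = cone - h ** h.
    have -> : h ** h = l + l - l ** l by rewrite -e2 addrK.
    rewrite cmulBr cmulx1 cmulBl cmul1x !opprB [LHS]addrA [LHS]addrAC.
    by rewrite [RHS]addrCA [RHS]addrC opprD !addrA.
  by rewrite addrC subrK.
Qed.

End SquareRoot.

Section Isometry.
Variables (R : realType) (A B : ucstarAlgType R) (f : A -> B).
Hypotheses (hf : star_hom f) (f1 : f cone = cone).

Lemma star1 (C : ucstarAlgType R) : star cone = cone :> C.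
Proof. by rewrite -[LHS]cmulx1 -{2}(starK cone) -starM cmulx1 starK. Qed.

Lemma norm1_le (C : ucstarAlgType R) : `|cone : C| <= 1.
Proof.
have [->|z0] := eqVneq (cone : C) 0; first by rewrite normr0.
rewrite -(ler_pM2r (_ : 0 < `|cone : C|)) ?normr_gt0// -expr2 -cnorm_star.
by rewrite star1 cmulx1 mul1r.
Qed.

Let sa_ball (h : A) : star h = h -> `|h| < 1 -> `|f h| <= 1.
Proof.
move=> hs h1; have [k [ks kh hk]] := sqrt_exists hs h1.
have [_ fM fS] := hf; have fD := star_homD hf.
pose u := f h + 'i *: f k; pose v := f h - 'i *: f k.
have uv : star u = v.
  by rewrite /u /v starD starZ -!fS hs ks -scaleNr; congr (_ + _ *: _); exact: conjCi.
have vu : v ** u = cone.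
  have vfh : v ** f h = f (h ** h) - 'i *: f (k ** h).
    by rewrite cmulBl cmulZl -!fM.
  have vfk : v ** f k = f (k ** h) - 'i *: f (k ** k).
    by rewrite cmulBl cmulZl -!fM kh.
  rewrite cmulDr cmulZr vfh vfk scalerBr scalerA -expr2 sqrCi scaleN1r opprK.
  by rewrite addrA subrK -fD hk f1.
have nu : `|u| <= 1.
  by rewrite -(@expr_le1 _ 2)// -cnorm_star uv vu norm1_le.
have nv : `|v| <= 1 by rewrite -uv norm_star.
have e2 : f h = 2^-1 *: (u + v).
  by rewrite addrACA subrr addr0 -mulr2n -[f h *+ 2]scaler_nat scalerA mulVf ?scale1r// pnatr_eq0.
rewrite e2 normrZ ger0_norm ?invr_ge0// mulrC ler_pdivrMr// mul1r.
by rewrite (le_trans (ler_normD _ _))// lerD.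
Qed.

Let sa_le (h : A) : star h = h -> `|f h| <= `|h|.
Proof.
move=> hs; have [->|h0] := eqVneq h 0; first by rewrite (star_hom0 hf) !normr0.
have nh : 0 < `|h| by rewrite normr_gt0.
apply: contraT; rewrite -real_ltNge ?normr_real// => lt.
have [lt1 lt2] := midf_lt lt; set t := _ / _ in lt1 lt2.
have t0 : 0 < t := lt_trans nh lt1.
have : `|f (t^-1 *: h)| <= 1.
  apply: sa_ball.
    by rewrite starZ hs conj_Creal// realV gtr0_real.
  by rewrite normrZ gtr0_norm ?invr_gt0// mulrC ltr_pdivrMr// mul1r.
rewrite (star_homZ hf) normrZ gtr0_norm ?invr_gt0// mulrC ler_pdivrMr// mul1r.
by rewrite lt_geF.
Qed.

Lemma star_hom_contractive x : `|f x| <= `|x|.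
Proof.
rewrite -ler_sqr ?nnegrE// -!cnorm_star.
by case: (hf) => _ fM fS; rewrite -fS -fM sa_le// starM starK.
Qed.
End Isometry.

Lemma star_auto_isometric (R : realType) (A : ucstarAlgType R) (f g : A -> A) :
  star_hom f -> star_hom g -> cancel f g -> cancel g f ->
  forall x, `|f x| = `|x|.
Proof.
have h1 (u v : A -> A) : star_hom u -> cancel v u -> u cone = cone.
  by case=> _ uM _ vK; rewrite -[LHS]cmulx1 -{2}(vK cone) -uM cmul1x vK.
move=> hf hg fK gK x; apply/eqP; rewrite eq_le star_hom_contractive ?(h1 _ _ hf gK)//=.
by rewrite -{1}(fK x) star_hom_contractive ?(h1 _ _ hg fK).
Qed.

Record cstar_subalg (R : realType) (B : cstarAlgType R) (D : set B) : Prop := {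
  csub0 : D 0;
  csubD : forall x y, D x -> D y -> D (x + y);
  csubZ : forall (c : R[i]) x, D x -> D (c *: x);
  csubM : forall x y, D x -> D y -> D (x ** y);
  csub_star : forall x, D x -> D (star x);
  csub_closed : closed D
}.

Definition generates (R : realType) (B : cstarAlgType R) (S : set B) : Prop :=
  forall D : set B, cstar_subalg D -> S `<=` D -> D = setT.

(* The carrier is a Banach space whose norm is |<x, x>|^(1/2) ([norm_inner]), so
   completeness is completeness of the Hilbert module and definiteness of the
   inner product follows.  Positivity in A is being of the form b^* b.
   [lact_adj] says that a |-> lact a is a *-preserving map into the adjointable
   operators, whence additivity and C-linearity of each [lact a]; as usual the
   left action is not required to be unital. *)
Record correspondence (R : realType) (A : cstarAlgType R) := Correspondence {
  cor_sort :> completeNormedModType R[i];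
  lact : A -> cor_sort -> cor_sort;
  ract : cor_sort -> A -> cor_sort;
  inner : cor_sort -> cor_sort -> A;
  ractDl : forall x y a, ract (x + y) a = ract x a + ract y a;
  ractDr : forall x a b, ract x (a + b) = ract x a + ract x b;
  ractZl : forall (c : R[i]) x a, ract (c *: x) a = c *: ract x a;
  ractZr : forall (c : R[i]) x a, ract x (c *: a) = c *: ract x a;
  ractM : forall x a b, ract x (a ** b) = ract (ract x a) b;
  innerDr : forall x y z, inner x (y + z) = inner x y + inner x z;
  innerZr : forall (c : R[i]) x y, inner x (c *: y) = c *: inner x y;
  inner_ract : forall x y a, inner x (ract y a) = inner x y ** a;
  star_inner : forall x y, star (inner x y) = inner y x;
  inner_ge0 : forall x, exists b, inner x x = star b ** b;
  norm_inner : forall x, `|inner x x| = `|x| ^+ 2;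
  lactDl : forall a b x, lact (a + b) x = lact a x + lact b x;
  lactZl : forall (c : R[i]) a x, lact (c *: a) x = c *: lact a x;
  lactM : forall a b x, lact (a ** b) x = lact a (lact b x);
  lact_adj : forall a x y, inner (lact a x) y = inner x (lact (star a) y)
}.

Section Operators.
Variables (R : realType) (A : cstarAlgType R).
Implicit Types E F W : correspondence A.

Definition adjoint_of E F (T : E -> F) (S : F -> E) : Prop :=
  forall x y, inner (T x) y = inner x (S y).

Definition adjointable E F (T : E -> F) : Prop := exists S, adjoint_of T S.

Definition unitary E F (U : E -> F) : Prop :=
  exists V, [/\ adjoint_of U V, cancel U V & cancel V U].

Definition theta E (x y z : E) : E := ract x (inner y z).

(* A C*-subalgebra of L(E); [ops_closed] is closedness in the operator norm,
   with |T - S| <= e spelled out. *)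
Record op_cstar_subalg E (D : set (E -> E)) : Prop := {
  ops_adj : forall T, D T -> adjointable T;
  ops0 : D (fun=> 0);
  opsD : forall S T, D S -> D T -> D (fun x => S x + T x);
  opsZ : forall (c : R[i]) T, D T -> D (fun x => c *: T x);
  opsM : forall S T, D S -> D T -> D (S \o T);
  ops_star : forall S T, D T -> adjoint_of T S -> D S;
  ops_closed : forall T, adjointable T ->
    (forall e : R[i], 0 < e ->
      exists2 S, D S & forall x, `|T x - S x| <= e * `|x|) -> D T
}.

Definition compact_op E (T : E -> E) : Prop :=
  forall D : set (E -> E), op_cstar_subalg D ->
    (forall x y, D (theta x y)) -> D T.

(* W, with the map (x, y) |-> x (x) y, is the interior tensor product of E and F:
   these conditions determine it up to a unique unitary bimodule map. *)
Record interior_tensor E F W (tau : E -> F -> W) : Prop := {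
  tensorDl : forall x x' y, tau (x + x') y = tau x y + tau x' y;
  tensorDr : forall x y y', tau x (y + y') = tau x y + tau x y';
  tensorZl : forall (c : R[i]) x y, tau (c *: x) y = c *: tau x y;
  tensorZr : forall (c : R[i]) x y, tau x (c *: y) = c *: tau x y;
  tensor_bal : forall x a y, tau (ract x a) y = tau x (lact a y);
  tensor_inner : forall x y x' y',
    inner (tau x y) (tau x' y') = inner y (lact (inner x x') y');
  tensor_lact : forall a x y, lact a (tau x y) = tau (lact a x) y;
  tensor_ract : forall a x y, ract (tau x y) a = tau x (ract y a);
  tensor_dense : closure
    [set t | exists s : seq (E * F), t = \sum_(u <- s) tau u.1 u.2] = setT
}.

End Operators.

Section RegularCorrespondence.
Variables (R : realType) (A : cstarAlgType R).

Definition regular_correspondence : correspondence A.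
Proof.
refine (@Correspondence R A A (@cmul R A) (@cmul R A) (fun a b => star a ** b)
  _ _ _ _ _ _ _ _ _ _ _ _ _ _ _); intros.
- exact: cmulDl.
- exact: cmulDr.
- exact: cmulZl.
- exact: cmulZr.
- exact: cmulA.
- exact: cmulDr.
- exact: cmulZr.
- exact: cmulA.
- by rewrite starM starK.
- by exists x.
- exact: cnorm_star.
- exact: cmulDl.
- exact: cmulZl.
- by rewrite cmulA.
- by rewrite starM cmulA.
Defined.

End RegularCorrespondence.

(* Fibres over equal but not convertible indices, such as p * (q * r) and
   p * q * r, are different types: vectors in them are compared in the disjoint
   union of the fibres. *)
Definition vec (R : realType) (P : Type) (A : cstarAlgType R)
  (X : P -> correspondence A) p (x : X p) : {p & X p} := existT _ p x.

(* [psunit] is the identification of A with the fibre over 1, an isomorphism of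
   correspondences. *)
Record productSystem (R : realType) (P : monoidType) (A : cstarAlgType R) :=
  ProductSystem {
  fib :> P -> correspondence A;
  psmul : forall p q, fib p -> fib q -> fib (p * q)%g;
  psunit : regular_correspondence A -> fib 1%g;
  psunit_linear : linear psunit;
  psunit_unitary : unitary psunit;
  psunit_lact : forall a b, psunit (a ** b) = lact a (psunit b);
  psunit_ract : forall a b, psunit (a ** b) = ract (psunit a) b;
  psmulA : forall p q r (x : fib p) (y : fib q) (z : fib r),
    vec (psmul x (psmul y z)) = vec (psmul (psmul x y) z);
  psmul_unitary : forall p q, exists (T : correspondence A)
    (tau : fib p -> fib q -> T) (M : T -> fib (p * q)%g),
    [/\ interior_tensor tau, unitary M & forall x y, M (tau x y) = psmul x y];
  psmul1x : forall p a (x : fib p),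
    vec (psmul (psunit a) x) = vec (lact a x);
  psmulx1 : forall p (x : fib p) a,
    vec (psmul x (psunit a)) = vec (ract x a)
}.

(* [act g p] is g . p and [res p g] is g|_p. *)
Record zsPair (P : monoidType) (G : groupType) := ZSPair {
  act : G -> P -> P;
  res : P -> G -> G;
  act1p : forall p, act 1%g p = p;
  actM : forall g h p, act (g * h)%g p = act g (act h p);
  actp1 : forall g, act g 1%g = 1%g;
  resg1 : forall g, res 1%g g = g;
  act_mul : forall g p q, act g (p * q)%g = (act g p * act (res p g) q)%g;
  res_mul : forall g p q, res (p * q)%g g = res q (res p g);
  res1 : forall p, res p 1%g = 1%g;
  resM : forall p g h, res p (g * h)%g = (res (act h p) g * res p h)%g
}.

Definition zsProduct (P : monoidType) (G : groupType) (Z : zsPair P G) : Type :=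
  (P * G)%type.

Section ZSMonoid.
Variables (P : monoidType) (G : groupType) (Z : zsPair P G).

HB.instance Definition _ := Choice.copy (zsProduct Z) (P * G)%type.

Definition zs_one : zsProduct Z := (1%g, 1%g).

Definition zs_mul (u v : zsProduct Z) : zsProduct Z :=
  ((u.1 * act Z u.2 v.1)%g, (res Z v.1 u.2 * v.2)%g).

Fact zs_mulA : associative zs_mul.
Proof.
move=> [p g] [q h] [r k]; rewrite /zs_mul /= act_mul mulgA actM.
by rewrite res_mul resM !mulgA.
Qed.

Fact zs_mul1 : left_id zs_one zs_mul.
Proof. by move=> [p g]; rewrite /zs_mul /= act1p res1 !mul1g. Qed.

Fact zs_mulr1 : right_id zs_one zs_mul.
Proof. by move=> [p g]; rewrite /zs_mul /= actp1 resg1 !mulg1. Qed.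

HB.instance Definition _ := isMonoid.Build (zsProduct Z) zs_mulA zs_mul1 zs_mulr1.

End ZSMonoid.

(* [beta_unit g] is the restriction of [beta g] to A = X_1; [beta_unitE] determines
   it, since [psunit] is injective. *)
Record zsSystem (R : realType) (P : monoidType) (G : groupType) (Z : zsPair P G)
    (A : cstarAlgType R) (X : productSystem P A) := ZSSystem {
  beta : forall g p, X p -> X (act Z g p);
  beta_unit : G -> A -> A;
  beta_linear : forall g p, linear (@beta g p);
  betaM : forall g h p (x : X p),
    vec (beta g (beta h x)) = vec (beta (g * h)%g x);
  beta1 : forall p (x : X p), vec (beta 1%g x) = vec x;
  beta_unitE : forall g (a : A),
    vec (beta g (psunit X a)) = vec (psunit X (beta_unit g a));
  beta_unit_hom : forall g, star_hom (beta_unit g);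
  beta_unit_bij : forall g, bijective (beta_unit g);
  beta_mul : forall g p q (x : X p) (y : X q),
    vec (beta g (psmul x y)) =
    vec (psmul (beta g x) (beta (res Z p g) y));
  beta_inner : forall g p (x y : X p),
    inner (beta g x) (beta g y) = beta_unit (res Z p g) (inner x y)
}.

Section VecTheory.
Variables (R : realType) (P : monoidType) (A : cstarAlgType R).
Variables (X : productSystem P A).

Lemma vec_inj p (x y : X p) : vec x = vec y -> x = y.
Proof. exact: eq_from_Tagged. Qed.

Lemma vec_psmul p q p' q' (x : X p) (y : X q) (x' : X p') (y' : X q') :
  vec x = vec x' -> vec y = vec y' -> vec (psmul x y) = vec (psmul x' y').
Proof. exact: (congr2 (fun u v => vec (psmul (projT2 u) (projT2 v)))). Qed.

Lemma vec_lact a p q (x : X p) (y : X q) :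
  vec x = vec y -> vec (lact a x) = vec (lact a y).
Proof. exact: (congr1 (fun u => vec (lact a (projT2 u)))). Qed.

Lemma vec_ract a p q (x : X p) (y : X q) :
  vec x = vec y -> vec (ract x a) = vec (ract y a).
Proof. exact: (congr1 (fun u => vec (ract (projT2 u) a))). Qed.

Lemma vec_inner p q (x x' : X p) (y y' : X q) :
  vec x = vec y -> vec x' = vec y' -> inner x x' = inner y y'.
Proof.
move=> e; have pq : p = q := congr1 (@projT1 _ _) e.
by case: _ / pq y y' e => y y' /vec_inj -> /vec_inj ->.
Qed.

Lemma psunit_inj : injective (psunit X).
Proof. by have [V [_ VK _]] := psunit_unitary X; exact: can_inj VK. Qed.

End VecTheory.

Section BowtieTheory.
Variables (R : realType) (P : monoidType) (G : groupType) (Z : zsPair P G).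
Variables (A : ucstarAlgType R) (X : productSystem P A) (b : zsSystem Z X).

Lemma vec_beta g p q (x : X p) (y : X q) :
  vec x = vec y -> vec (beta b g x) = vec (beta b g y).
Proof. exact: (congr1 (fun u => vec (beta b g (projT2 u)))). Qed.

Lemma beta_unitM g h a : beta_unit b g (beta_unit b h a) = beta_unit b (g * h)%g a.
Proof.
apply: (@psunit_inj _ _ _ X); apply: vec_inj.
rewrite -(beta_unitE b g) -(vec_beta g (beta_unitE b h a)) betaM.
by rewrite (beta_unitE b).
Qed.

Lemma beta_unit1 a : beta_unit b 1%g a = a.
Proof. by apply: (@psunit_inj _ _ _ X); apply: vec_inj; rewrite -beta_unitE beta1. Qed.

Lemma beta_unitK g : cancel (beta_unit b g) (beta_unit b g^-1%g).
Proof. by move=> a; rewrite beta_unitM mulVg beta_unit1. Qed.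

Lemma beta_unitVK g : cancel (beta_unit b g^-1%g) (beta_unit b g).
Proof. by move=> a; rewrite beta_unitM mulgV beta_unit1. Qed.

Lemma norm_beta_unit g a : `|beta_unit b g a| = `|a|.
Proof.
exact: (star_auto_isometric (beta_unit_hom b g) (beta_unit_hom b g^-1%g)
  (beta_unitK g) (beta_unitVK g)).
Qed.

Lemma beta_lact g p a (x : X p) :
  beta b g (lact a x) = lact (beta_unit b g a) (beta b g x).
Proof.
apply/vec_inj; rewrite -(vec_beta g (psmul1x a x)) beta_mul.
by rewrite -psmul1x; apply: vec_psmul; [exact: beta_unitE|rewrite resg1].
Qed.

Lemma beta_ract g p a (x : X p) :
  beta b g (ract x a) = ract (beta b g x) (beta_unit b (res Z p g) a).
Proof.
apply/vec_inj; rewrite -(vec_beta g (psmulx1 x a)) beta_mul.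
by rewrite -psmulx1; apply: vec_psmul => //; exact: beta_unitE.
Qed.

(* The fibre over (p, g) has X_p as carrier: x stands for x (x) g. *)
Definition bowtie_fib (u : zsProduct Z) : correspondence A.
Proof.
refine (@Correspondence R A (X u.1) (@lact R A (X u.1))
  (fun x a => ract x (beta_unit b u.2 a))
  (fun x y => beta_unit b u.2^-1%g (inner x y)) _ _ _ _ _ _ _ _ _ _ _ _ _ _ _).
all: have hb := beta_unit_hom b; have [bM bS] : (forall g, {morph beta_unit b g : x y / x ** y}) /\ (forall g, {morph beta_unit b g : x / star x}) by (split => g; have [_ ? ?] := hb g).
- by move=> *; exact: ractDl.
- by move=> *; rewrite (star_homD (hb _)) ractDr.
- by move=> *; exact: ractZl.
- by move=> *; rewrite (star_homZ (hb _)) ractZr.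
- by move=> *; rewrite bM ractM.
- by move=> *; rewrite innerDr (star_homD (hb _)).
- by move=> *; rewrite innerZr (star_homZ (hb _)).
- by move=> *; rewrite inner_ract bM beta_unitK.
- by move=> *; rewrite -bS star_inner.
- by move=> x; have [c ->] := inner_ge0 x; exists (beta_unit b u.2^-1%g c); rewrite bM bS.
- by move=> *; rewrite norm_beta_unit norm_inner.
- by move=> *; exact: lactDl.
- by move=> *; exact: lactZl.
- by move=> *; exact: lactM.
- by move=> *; rewrite lact_adj.
Defined.

Definition bowtie_mul (u v : zsProduct Z) (x : bowtie_fib u) (y : bowtie_fib v) :
  bowtie_fib (u * v)%g := psmul (x : X u.1) (beta b u.2 (y : X v.1)).

Definition bowtie_unit (a : regular_correspondence A) : bowtie_fib 1%g := psunit X a.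

End BowtieTheory.

Section CorrespondenceTheory.
Variables (R : realType) (A : cstarAlgType R).
Implicit Types E F W : correspondence A.

Lemma innerDl E (x y z : E) : inner (x + y) z = inner x z + inner y z.
Proof. by rewrite -star_inner innerDr starD !star_inner. Qed.

Lemma innerZl E (c : R[i]) (x y : E) : inner (c *: x) y = c^* *: inner x y.
Proof. by rewrite -star_inner innerZr starZ star_inner. Qed.

Lemma innerBl E (x y z : E) : inner (x - y) z = inner x z - inner y z.
Proof. by rewrite innerDl -scaleN1r innerZl rmorphN1 scaleN1r. Qed.

Lemma inner_sep E (x y : E) : (forall z, inner x z = inner y z) -> x = y.
Proof.
move=> h; apply/eqP; rewrite -subr_eq0 -normr_eq0 -sqrf_eq0 -norm_inner normr_eq0.
by rewrite innerBl h subrr.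
Qed.

Section Unitary.
Variables (E F : correspondence A) (U : E -> F) (V : F -> E).
Hypotheses (UV : adjoint_of U V) (UK : cancel U V) (VK : cancel V U).

Lemma unitary_inner x y : inner (U x) (U y) = inner x y.
Proof. by rewrite UV UK. Qed.

Lemma unitaryD : {morph U : x y / x + y}.
Proof. by move=> x y; apply: inner_sep => z; rewrite innerDl !UV innerDl. Qed.

Lemma unitaryZ (c : R[i]) x : U (c *: x) = c *: U x.
Proof. by apply: inner_sep => z; rewrite innerZl !UV innerZl. Qed.

Lemma norm_unitary x : `|U x| = `|x|.
Proof.
by apply/eqP; rewrite -(@eqrXn2 _ 2)// -!norm_inner unitary_inner.
Qed.

Lemma unitary_sum I (r : seq I) (f : I -> E) :
  U (\sum_(i <- r) f i) = \sum_(i <- r) U (f i).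
Proof.
have U0 : U 0 = 0 by rewrite -(scale0r 0) unitaryZ scale0r.
exact: (big_morph U unitaryD U0).
Qed.

Lemma unitary_closure (S : set E) : closure S = setT ->
  closure (U @` S) = setT.
Proof.
move=> dS; apply/seteqP; split => // y _ B /nbhs_ballP[e /= e0 eB].
have : closure S (V y) by rewrite dS.
move=> /(_ _ (nbhsx_ballx (V y) e e0))[x [Sx]].
rewrite -ball_normE /= => xe; exists (U x); split; first by exists x.
apply: eB; rewrite -ball_normE /= -{1}(VK y).
rewrite -scaleN1r -unitaryZ -unitaryD norm_unitary scaleN1r//.
Qed.

End Unitary.
End CorrespondenceTheory.

Section ProductSystemTheory.
Variables (R : realType) (P : monoidType) (A : cstarAlgType R).
Variables (X : productSystem P A).

Lemma psmul_tensor p q : interior_tensor (@psmul R P A X p q).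
Proof.
have [W [tau [M [ht [V [MV MK VK]] Mtau]]]] := psmul_unitary X p q.
have MD := unitaryD MV; have MZ := unitaryZ MV.
split.
- by move=> *; rewrite -!Mtau tensorDl.
- by move=> *; rewrite -!Mtau tensorDr.
- by move=> *; rewrite -!Mtau tensorZl.
- by move=> *; rewrite -!Mtau tensorZr.
- by move=> *; rewrite -!Mtau tensor_bal.
- by move=> *; rewrite -!Mtau (unitary_inner MV MK) tensor_inner.
- move=> a x y; apply: vec_inj; rewrite -psmul1x psmulA.
  by apply: vec_psmul => //; exact: psmul1x.
- move=> a x y; apply: vec_inj; rewrite -psmulx1 -psmulA.
  by apply: vec_psmul => //; exact: psmulx1.
- rewrite -(unitary_closure MV MK VK (tensor_dense ht)); congr closure.
  apply/seteqP; split => [t [s ->]|t [_ [s ->] <-]].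
    exists (\sum_(u <- s) tau u.1 u.2); first by exists s.
    by rewrite (unitary_sum MV); apply: eq_bigr => u _; exact: Mtau.
  exists s; rewrite (unitary_sum MV); apply: eq_bigr => u _; exact: Mtau.
Qed.

End ProductSystemTheory.

Section Bowtie.
Variables (R : realType) (P : monoidType) (G : groupType) (Z : zsPair P G).
Variables (A : ucstarAlgType R) (X : productSystem P A) (b : zsSystem Z X).

Lemma vec_cast p q (x : X p) : p = q -> exists y : X q, vec y = vec x.
Proof. by move=> e; case: _ / e; exists x. Qed.

Lemma beta_surj g q (y : X (act Z g q)) : exists x, beta b g x = y.
Proof.
have e : act Z g^-1%g (act Z g q) = q by rewrite -actM mulVg act1p.
have [x hx] := vec_cast (beta b g^-1%g y) e.
by exists x; apply: vec_inj; rewrite (vec_beta b g hx) betaM mulgV beta1.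
Qed.

Lemma vec_bowtie (u v : zsProduct Z) (x : X u.1) (y : X v.1) :
  u.2 = v.2 -> vec x = vec y ->
  vec (x : bowtie_fib b u) = vec (y : bowtie_fib b v).
Proof.
case: u v x y => p g [q h] /= x y gh; rewrite {g}gh => e.
have pq : p = q := congr1 (@projT1 _ _) e.
by case: _ / pq y e => y /vec_inj ->.
Qed.

Lemma bowtie_tensor u v : interior_tensor (@bowtie_mul R P G Z A X b u v).
Proof.
case: u v => p g [q h]; have T := psmul_tensor X p (act Z g q).
have hb := beta_unit_hom b.
have bD : {morph @beta _ _ _ _ _ _ b g q : x y / x + y}.
  by move=> x y; have := beta_linear b g 1 x y; rewrite !scale1r.
have b0 : beta b g (0 : X q) = 0 by apply: (addIr (beta b g (0 : X q))); rewrite -bD !add0r.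
have bZ (c : R[i]) (x : X q) : beta b g (c *: x) = c *: beta b g x.
  by have := beta_linear b g c x 0; rewrite !addr0 b0 addr0.
rewrite /bowtie_mul; split => /=.
- by move=> *; exact: (tensorDl T).
- by move=> x y y'; rewrite bD (tensorDr T).
- by move=> *; exact: (tensorZl T).
- by move=> c x y; rewrite bZ (tensorZr T).
- by move=> x a y; rewrite (tensor_bal T) beta_lact.
- move=> x y x' y'; rewrite (tensor_inner T).
  rewrite -{1}(beta_unitVK b g (inner x x')) -beta_lact beta_inner beta_unitM.
  by rewrite invgM -mulgA mulVg mulg1.
- by move=> a x y; exact: (tensor_lact T).
- by move=> a x y; rewrite (tensor_ract T) beta_ract beta_unitM.
- rewrite -(tensor_dense T); congr closure.
  apply/seteqP; split => [t [s ->]|t [s ->]].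
    exists [seq (w.1, beta b g w.2) | w <- s].
    by rewrite big_map.
  elim: s => [|[x y] s [s' IH]]; first by exists [::]; rewrite !big_nil.
  have [y' hy] := beta_surj y; exists ((x, y') :: s').
  by rewrite !big_cons IH /= hy.
Qed.

Definition bowtie : productSystem (zsProduct Z) A.
Proof.
refine (@ProductSystem R (zsProduct Z) A (bowtie_fib b) (@bowtie_mul R P G Z A X b)
  (@bowtie_unit R P G Z A X b) _ _ _ _ _ _ _ _).
- exact: psunit_linear.
- have [V [UV UK VK]] := psunit_unitary X; exists V; split=> // a x.
  by rewrite /= invg1 beta_unit1; exact: UV.
- exact: psunit_lact.
- by move=> a c; rewrite /bowtie_unit /= beta_unit1 psunit_ract.
- move=> u v w x y z; apply: vec_bowtie; first exact: (congr1 snd (mulgA u v w)).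
  rewrite /bowtie_mul -psmulA; apply: vec_psmul => //.
  by rewrite beta_mul; apply: vec_psmul => //; exact: betaM.
- move=> u v; exists (bowtie_fib b (u * v)%g), (@bowtie_mul R P G Z A X b u v), id.
  split => //; first exact: bowtie_tensor.
  by exists id.
- move=> [p g] a x; apply: vec_bowtie => /=.
    by rewrite res1 mul1g.
  rewrite -psmul1x; apply: vec_psmul => //; exact: beta1.
- move=> [p g] x a; apply: vec_bowtie => /=.
    by rewrite resg1 mulg1.
  by rewrite -psmulx1; apply: vec_psmul => //; exact: beta_unitE.
Defined.

End Bowtie.

Section Representations.
Variables (R : realType) (P : monoidType) (A : cstarAlgType R).
Variables (X : productSystem P A) (B : cstarAlgType R).

Record representation (psi : forall p, X p -> B) : Prop := {
  rep_linear : forall p, linear (@psi p);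
  rep_unit : star_hom (fun a : A => psi _ (psunit X a));
  repM : forall p q (x : X p) (y : X q),
    psi _ x ** psi _ y = psi _ (psmul x y);
  rep_inner : forall p (x y : X p),
    star (psi _ x) ** psi _ y = psi _ (psunit X (inner x y))
}.

(* [Psi], whose values outside of the compact operators are irrelevant, is the
   *-homomorphism psi^(p) on K(X_p); the conditions determine it there. *)
Record induced_hom (psi : forall p, X p -> B) (p : P) (Psi : (X p -> X p) -> B) :
    Prop := {
  indD : forall S T : X p -> X p, compact_op S -> compact_op T ->
    Psi (fun x => S x + T x) = Psi S + Psi T;
  indZ : forall (c : R[i]) (T : X p -> X p), compact_op T ->
    Psi (fun x => c *: T x) = c *: Psi T;
  indM : forall S T : X p -> X p, compact_op S -> compact_op T ->
    Psi (S \o T) = Psi S ** Psi T;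
  ind_star : forall S T : X p -> X p, compact_op T -> adjoint_of T S ->
    Psi S = star (Psi T);
  ind_theta : forall x y : X p, Psi (theta x y) = psi p x ** star (psi p y)
}.

Definition cuntz_pimsner_covariant (psi : forall p, X p -> B) : Prop :=
  forall p, exists2 Psi : (X p -> X p) -> B, induced_hom psi Psi &
    forall a, compact_op (@lact R A (X p) a) ->
      Psi (lact a) = psi _ (psunit X a).

End Representations.

(* (O, j) is the universal C*-algebra for Cuntz-Pimsner covariant representations
   of X, with its universal representation. *)
Record cuntz_pimsner_algebra (R : realType) (P : monoidType)
    (A : cstarAlgType R) (X : productSystem P A)
    (O : cstarAlgType R) (j : forall p, X p -> O) : Prop := {
  cpa_rep : representation j;
  cpa_cov : cuntz_pimsner_covariant j;
  cpa_gen : generates [set z | exists p (x : X p), z = j p x];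
  cpa_univ : forall (B : cstarAlgType R) (psi : forall p, X p -> B),
    representation psi -> cuntz_pimsner_covariant psi ->
    exists2 f : O -> B, star_hom f & forall p (x : X p), f (j p x) = psi p x
}.

(* A and B are unital and psi is required to be so ([cov_unit]).  Without this,
   psi = 0 with any unitary representation U would qualify, and the algebra
   generated by the universal pair would acquire C*(G) as a direct summand. *)
Record covariant_representation (R : realType) (P : monoidType) (G : groupType)
    (Z : zsPair P G) (A : ucstarAlgType R) (X : productSystem P A)
    (b : zsSystem Z X) (B : ucstarAlgType R)
    (psi : forall p, X p -> B) (U : G -> B) : Prop := {
  cov_rep : representation psi;
  cov_unit : psi _ (psunit X cone) = cone;
  cov_U1 : U 1%g = cone;
  cov_UM : forall g h, U (g * h)%g = U g ** U h;
  cov_unitaryl : forall g, star (U g) ** U g = cone;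
  cov_unitaryr : forall g, U g ** star (U g) = cone;
  cov_cov : forall g p (x : X p),
    U g ** psi p x = psi _ (beta b g x) ** U (res Z p g)
}.

(* (B, psi, U) is the universal C*-algebra generated by the covariant
   representations of (X, G, b) whose first component is Cuntz-Pimsner
   covariant. *)
Record cuntz_pimsner_bowtie_algebra (R : realType) (P : monoidType)
    (G : groupType) (Z : zsPair P G) (A : ucstarAlgType R)
    (X : productSystem P A) (b : zsSystem Z X) (B : ucstarAlgType R)
    (psi : forall p, X p -> B) (U : G -> B) : Prop := {
  cpb_rep : covariant_representation b psi U;
  cpb_cov : cuntz_pimsner_covariant psi;
  cpb_gen : generates
    ([set z | exists p (x : X p), z = psi p x] `|` [set z | exists g, z = U g]);
  cpb_univ : forall (C : ucstarAlgType R) (psi' : forall p, X p -> C) (U' : G -> C),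
    covariant_representation b psi' U' -> cuntz_pimsner_covariant psi' ->
    exists f : B -> C, [/\ star_hom f,
      forall p (x : X p), f (psi p x) = psi' p x & forall g, f (U g) = U' g]
}.

(* Main.v *)
(* A covariant pair (psi, U) gives the representation x (x) g |-> psi_p(x) U_g of
   the bowtie system, and a representation j of the bowtie system gives the pair
   (x |-> j(x (x) e), g |-> j(1 (x) g)).  Both passages preserve Cuntz-Pimsner
   covariance, because the fibre over (p, g) has the same compact operators and
   the same left action as X_p, and U_g is unitary.  The universal properties
   give *-homomorphisms both ways, inverse to each other on generators and hence,
   being contractive, everywhere.  The algebra O_(X bowtie G) is unital, with unit
   j(1 (x) e), because the left action of A is automatically unital. *)
Require Import Defs.
From mathcomp Require Import all_boot all_order all_algebra complex.
From mathcomp Require Import all_classical all_reals topology normedtype.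
Set Implicit Arguments. Unset Strict Implicit. Unset Printing Implicit Defensive.
Import Order.TTheory GRing.Theory Num.Theory.
Import numFieldNormedType.Exports.
Local Open Scope classical_set_scope.
Local Open Scope ring_scope.

(** * Fixed points and units of a C*-algebra given by generators *)

Section Generation.
Variables (R : realType) (B : cstarAlgType R).

Lemma closed_normP (D : set B) :
  (forall x, (forall e : R[i], 0 < e -> exists2 y, D y & `|x - y| < e) -> D x) ->
  closed D.
Proof.
move=> h x cx; apply: h => e e0.
have [y [Dy]] := cx _ (nbhsx_ballx x e e0).
by rewrite -ball_normE /= => xy; exists y.
Qed.

(** Contractivity gives closedness: if [y] is fixed and near [x], then [k x - y = k (x - y)] is
    small, so [k x] is near [x]. *)
Lemma subalg_fixed (k : B -> B) : star_hom k -> (forall x, `|k x| <= `|x|) ->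
  cstar_subalg [set x | k x = x].
Proof.
move=> hk kc; have [_ kM kS] := hk; have kD := star_homD hk.
split => /=.
- exact: (star_hom0 hk).
- by move=> x y kx ky; rewrite kD kx ky.
- by move=> c x kx; rewrite (star_homZ hk) kx.
- by move=> x y kx ky; rewrite kM kx ky.
- by move=> x kx; rewrite kS kx.
apply: closed_normP => x hx /=; apply/eqP; rewrite -subr_eq0; apply/eqP.
apply: (@eps0 _ _ _ 2) => // e e0; have [y ky xy] := hx e e0.
have kB : k (x - y) = k x - y by rewrite kD -scaleN1r (star_homZ hk) ky.
rewrite (le_trans (ler_distD y _ _))// mulr_natl mulr2n lerD//.
  by rewrite -kB (le_trans (kc _))// ltW.
by rewrite distrC ltW.
Qed.

(** Imposing both equations makes the set stable under [star], which exchanges them when [e] is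
    self-adjoint. *)
Lemma subalg_unit (e : B) : star e = e ->
  cstar_subalg [set x | e ** x = x /\ x ** e = x].
Proof.
move=> es; split => /=.
- by rewrite cmul0x cmulx0.
- by move=> x y [ex xe] [ey ye]; rewrite cmulDl cmulDr ex xe ey ye.
- by move=> c x [ex xe]; rewrite cmulZl cmulZr ex xe.
- by move=> x y [ex xe] [ey ye]; rewrite cmulA ex -cmulA ye.
- by move=> x [ex xe]; split; rewrite -{1}es -starM ?ex ?xe.
apply: closed_normP => x hx /=.
have [le re] : `|e ** x - x| = 0 /\ `|x ** e - x| = 0.
  have small (z : B) : (forall d, 0 < d -> `|z| <= (`|e| + 1) * d) -> `|z| = 0.
    by move=> /eps0 ->; rewrite ?normr0 ?addr_ge0.
  split; apply: small => d d0; have [y [ey ye] xy] := hx d d0;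
    rewrite (le_trans (ler_distD y _ _))// mulrDl mul1r lerD//;
    try by rewrite distrC ltW.
    by rewrite -{1}ey -cmulBr (le_trans (cnormM _ _))// ler_wpM2l// ltW.
  by rewrite -{1}ye -cmulBl (le_trans (cnormM _ _))// mulrC ler_wpM2l// ltW.
by split; apply/eqP; rewrite -subr_eq0 -normr_eq0 ?le ?re.
Qed.

Lemma generated_fixed (S : set B) (k : B -> B) : generates S ->
  star_hom k -> (forall x, `|k x| <= `|x|) -> (forall x, S x -> k x = x) ->
  forall x, k x = x.
Proof.
by move=> gS hk kc kS x; have := gS _ (subalg_fixed hk kc) kS => /seteqP[_]; apply.
Qed.

Lemma generated_unit (S : set B) (e : B) : generates S -> star e = e ->
  (forall x, S x -> e ** x = x /\ x ** e = x) ->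
  left_id e (@cmul R B) /\ right_id e (@cmul R B).
Proof.
move=> gS es eS; have := gS _ (subalg_unit es) eS => /seteqP[_ h].
by split => x; have [] := h x I.
Qed.

End Generation.

(** * The unit of the coefficient algebra acts trivially on both sides *)

Section Modules.
Variables (R : realType) (A : ucstarAlgType R).

Lemma ractx1 (E : correspondence A) (x : E) : ract x cone = x.
Proof.
by apply: inner_sep => z; rewrite -[LHS]star_inner inner_ract cmulx1 star_inner.
Qed.

Lemma lact_linear (E : correspondence A) (a : A) : linear (@lact R A E a).
Proof.
move=> c x y; apply: inner_sep => z.
by rewrite lact_adj !innerDl !innerZl !lact_adj.
Qed.

(* If [w] is orthogonal to [z], then [z + w] and [z - w] have the same norm, so
   [z] is as small as [z - w]: this replaces the Cauchy-Schwarz inequality. *)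
Lemma orthogonal_dense (E : correspondence A) (S : set E) (z : E) :
  closure S = setT -> (forall w, S w -> inner z w = 0) -> z = 0.
Proof.
move=> dS zS; apply/eqP; rewrite -normr_eq0; apply: contraT => nz.
have nz0 : 0 < `|z| by rewrite lt_def nz normr_ge0.
have : closure S z by rewrite dS.
move=> /(_ _ (nbhsx_ballx z `|z| nz0))[w [Sw]]; rewrite -ball_normE /= => zw.
have wz : inner w z = 0 by rewrite -star_inner zS// star0.
have nzw : `|z + w| = `|z - w|.
  have zNw : inner z (- w) = 0 by rewrite -scaleN1r innerZr zS// scaler0.
  have wNw : inner w (- w) = - inner w w by rewrite -scaleN1r innerZr scaleN1r.
  apply/eqP; rewrite -(@eqrXn2 _ 2)// -!norm_inner innerBl innerDl !innerDr.
  by rewrite (zS w)// wz zNw wNw !addr0 !add0r opprK.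
have : `|z + z| < `|z| + `|z|.
  have -> : z + z = (z + w) + (z - w) by rewrite addrACA subrr addr0.
  by rewrite (le_lt_trans (ler_normD _ _))// nzw ltrD.
by rewrite -mulr2n normrMn mulr2n ltxx.
Qed.

(* The left action is not assumed unital, but [psmul : X_1 (x) X_p -> X_p] has
   dense range. *)
Lemma lact1x (P : monoidType) (X : productSystem P A) p (x : X p) :
  lact cone x = x.
Proof.
have [V [_ _ VK]] := psunit_unitary X.
have lact1_unit (y : X 1%g) : lact cone y = y.
  by rewrite -(VK y) -psunit_lact cmul1x.
have T := psmul_tensor X 1%g p.
(* As [cone] is self-adjoint, pairing [lact cone y - y] with a sum of products moves [lact cone]
   onto that sum, where it meets only the factors in [X 1]. *)
have lact1 (y : X (1 * p)%g) : lact cone y = y.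
  apply/eqP; rewrite -subr_eq0; apply/eqP.
  apply: (orthogonal_dense (tensor_dense T)) => w [s ->].
  have lact_sum : lact cone (\sum_(u <- s) psmul u.1 u.2) =
      \sum_(u <- s) psmul u.1 u.2.
    pose L := lact_linear (E := X (1 * p)%g) cone.
    elim: s => [|u s IH]; first by
      rewrite big_nil; have := L (-1) 0 0; rewrite scaler0 addr0 scaleN1r addNr.
    have := L 1 (psmul u.1 u.2) (\sum_(v <- s) psmul v.1 v.2).
    by rewrite !scale1r big_cons IH (tensor_lact T) lact1_unit.
  by rewrite innerBl lact_adj star1 lact_sum subrr.
have [y yx] := vec_cast x (esym (mul1g p)).
by apply: vec_inj; rewrite -(vec_lact cone yx) lact1.
Qed.

End Modules.

(** * Compact operators on the fibres of the bowtie system *)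

Section Fibres.
Variables (R : realType) (P : monoidType) (G : groupType) (Z : zsPair P G).
Variables (A : ucstarAlgType R) (X : productSystem P A) (b : zsSystem Z X).

Lemma beta_unit_one g : beta_unit b g cone = cone.
Proof.
have [_ bM _] := beta_unit_hom b g.
by rewrite -[LHS]cmulx1 -{2}(beta_unitVK b g cone) -bM cmul1x beta_unitVK.
Qed.

(** The twist of the right action by [u.2] cancels the twist of the inner product by its inverse. *)
Lemma theta_bowtie u (x y : X u.1) :
  theta (x : bowtie_fib b u) (y : bowtie_fib b u) = theta x y.
Proof. by apply/funext => z; rewrite /theta /= beta_unitVK. Qed.

Lemma adjoint_bowtie u (T S : X u.1 -> X u.1) :
  adjoint_of (E := bowtie_fib b u) (F := bowtie_fib b u) T S <->
  adjoint_of (E := X u.1) (F := X u.1) T S.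
Proof.
split=> h x y; last exact: (congr1 _ (h x y)).
exact: (can_inj (beta_unitVK b u.2) (h x y)).
Qed.

(** Adjoints, rank-one operators and the norm are the same in both modules, hence so are the
    C*-subalgebras of operators containing the rank-one ones. *)
Lemma compact_bowtie u (T : X u.1 -> X u.1) :
  compact_op (T : bowtie_fib b u -> bowtie_fib b u) <-> compact_op T.
Proof.
have adj (S : X u.1 -> X u.1) :
    adjointable (S : bowtie_fib b u -> bowtie_fib b u) <-> adjointable S.
  by split=> -[S' /adjoint_bowtie]; exists S'.
have sub D : op_cstar_subalg (D : set (bowtie_fib b u -> bowtie_fib b u)) <->
    op_cstar_subalg (D : set (X u.1 -> X u.1)).
  split=> -[h1 h2 h3 h4 h5 h6 h7]; split=> //.
  - by move=> S /h1/adj.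
  - by move=> S S' DS' /adjoint_bowtie; exact: h6.
  - by move=> S /adj; exact: h7.
  - by move=> S /h1/adj.
  - by move=> S S' DS' /adjoint_bowtie; exact: h6.
  - by move=> S /adj; exact: h7.
by split=> h D /sub hD tD; apply: h => // x y; rewrite ?theta_bowtie// -theta_bowtie.
Qed.

(** The two representations enter the definition only through their values on rank-one operators, so
    one [Psi] serves both. *)
Lemma induced_hom_bowtie u (B : cstarAlgType R) (psi : forall p, X p -> B)
    (phi : forall v, bowtie b v -> B) (Psi : (X u.1 -> X u.1) -> B) :
  (forall x y : X u.1, phi u x ** star (phi u y) = psi _ x ** star (psi _ y)) ->
  induced_hom psi Psi <-> @induced_hom _ _ _ (bowtie b) _ phi u Psi.
Proof.
move=> e; split=> -[h1 h2 h3 h4 h5]; split.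
- by move=> S T /compact_bowtie cS /compact_bowtie; exact: h1.
- by move=> c T /compact_bowtie; exact: h2.
- by move=> S T /compact_bowtie cS /compact_bowtie; exact: h3.
- by move=> S T /compact_bowtie cT /adjoint_bowtie; exact: h4.
- by move=> x y; rewrite e -h5; congr Psi; exact: theta_bowtie.
- by move=> S T /compact_bowtie cS /compact_bowtie; exact: h1.
- by move=> c T /compact_bowtie; exact: h2.
- by move=> S T /compact_bowtie cS /compact_bowtie; exact: h3.
- by move=> S T /compact_bowtie cT /adjoint_bowtie; exact: h4.
- by move=> x y; rewrite -e -h5; congr Psi; rewrite -theta_bowtie.
Qed.

End Fibres.

(* [O] is destructed because records have no definitional eta here: only then is
   the unital algebra built on it convertible to [O] itself. *)
Lemma unital_ind (R : realType) (Q : forall O : cstarAlgType R, O -> Prop) :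
  (forall O : ucstarAlgType R, Q O cone) ->
  forall (O : cstarAlgType R) (e : O),
    left_id e (@cmul R O) -> right_id e (@cmul R O) -> Q O e.
Proof.
move=> QO [T []] > e1x ex1.
pose u := CStarAlgebra_isUnital.Axioms_ _ _ e1x ex1.
exact (QO (UnitalCStarAlgebra.Pack (UnitalCStarAlgebra.Class u))).
Qed.

(** * From a covariant pair to a representation of the bowtie system *)

Section ToBowtie.
Variables (R : realType) (P : monoidType) (G : groupType) (Z : zsPair P G).
Variables (A : ucstarAlgType R) (X : productSystem P A) (b : zsSystem Z X).
Variables (B : ucstarAlgType R) (psi : forall p, X p -> B) (U : G -> B).
Arguments psi : clear implicits.
Hypothesis hU : covariant_representation b psi U.

Lemma rep_vec p q (x : X p) (y : X q) : vec x = vec y -> psi _ x = psi _ y.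
Proof. exact: (congr1 (fun u => psi _ (projT2 u))). Qed.

Definition bowtie_rep (u : zsProduct Z) (x : bowtie b u) : B :=
  psi _ (x : X u.1) ** U u.2.

Lemma cov_unit_cov g a :
  U g ** psi _ (psunit X a) = psi _ (psunit X (beta_unit b g a)) ** U g.
Proof.
rewrite (cov_cov hU) resg1; congr (_ ** _).
exact: (rep_vec (beta_unitE b g a)).
Qed.

Lemma bowtie_representation : representation bowtie_rep.
Proof.
have hr := cov_rep hU; rewrite /bowtie_rep; split.
- by move=> u c x y; rewrite (rep_linear hr) cmulDl cmulZl.
- have e a : psi _ (psunit X a) ** U 1%g = psi _ (psunit X a).
    by rewrite (cov_U1 hU) cmulx1.
  have [uL uM uS] := rep_unit hr.
  by split=> [c x y|x y|x] /=; rewrite !e ?uL ?uM ?uS.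
- move=> [p g] [q h] x y /=.
  rewrite cmulA -(cmulA (psi _ _)) (cov_cov hU) cmulA (repM hr) -cmulA.
  by rewrite -(cov_UM hU).
move=> [p g] x y /=; rewrite starM cmulA -(cmulA (star (U g))) (rep_inner hr).
(* Once the inner product is written as a value of [beta_unit b g], the right-hand [U g] can cross
   it and cancel against [star (U g)]. *)
rewrite (cov_U1 hU) cmulx1 -{1}(beta_unitVK b g (@inner _ _ (X p) x y)) -cmulA.
by rewrite -cov_unit_cov cmulA (cov_unitaryl hU) cmul1x.
Qed.

Lemma bowtie_rep_cov :
  cuntz_pimsner_covariant psi -> cuntz_pimsner_covariant bowtie_rep.
Proof.
move=> hc u; have [Psi hPsi aPsi] := hc u.1; exists Psi.
  apply: (iffLR (@induced_hom_bowtie _ _ _ _ _ _ b u _ psi bowtie_rep Psi _) hPsi).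
  move=> x y.
  by rewrite /bowtie_rep starM cmulA -(cmulA (psi _ _)) (cov_unitaryr hU) cmulx1.
move=> a /compact_bowtie ca.
by rewrite /bowtie_rep /= (cov_U1 hU) cmulx1; exact: aPsi.
Qed.

End ToBowtie.

(** * From a representation of the bowtie system to a covariant pair *)

Section FromBowtie.
Variables (R : realType) (P : monoidType) (G : groupType) (Z : zsPair P G).
Variables (A : ucstarAlgType R) (X : productSystem P A) (b : zsSystem Z X).
Variables (O : cstarAlgType R) (j : forall u : zsProduct Z, bowtie b u -> O).
Arguments j : clear implicits.
Hypothesis hj : representation j.

Definition rep_left p (x : X p) : O := j (p, 1%g) x.

Definition rep_group (g : G) : O := j (1%g, g) (psunit X cone).

(** The candidate unit of [O], convertible both to [rep_left (psunit X cone)] and to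
    [rep_group 1]. *)
Definition rep_one : O := j 1%g (bowtie_unit b cone).

(** Reduces identities between values of [j] over different indices to identities in [X] and in
    [G]. *)
Lemma j_vec u v (x : X u.1) (y : X v.1) :
  u.2 = v.2 -> vec x = vec y -> j u x = j v y.
Proof.
move=> uv e; have := vec_bowtie b uv e.
exact: (congr1 (fun w => j _ (projT2 w))).
Qed.

Lemma jM p g q h (x : X p) (y : X q) :
  j (p, g) x ** j (q, h) y =
  j ((p * act Z g q)%g, (res Z q g * h)%g) (psmul x (beta b g y)).
Proof. exact: (repM hj (p := (p, g)) (q := (q, h))). Qed.

Lemma rep_one_star : star rep_one = rep_one.
Proof.
have [_ _ jS] := rep_unit hj; rewrite /rep_one -[bowtie_unit _ _]/(psunit (bowtie b) cone).
by rewrite -jS star1.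
Qed.

Lemma rep_one_l u x : rep_one ** j u x = j u x.
Proof.
case: u x => p g x; rewrite jM; apply: j_vec; first by rewrite /= res1 mul1g.
by rewrite (vec_psmul (erefl _) (beta1 b x)) psmul1x lact1x.
Qed.

Lemma rep_left_group p g (x : X p) : rep_left x ** rep_group g = j (p, g) x.
Proof.
rewrite jM; apply: j_vec; first by rewrite /= res1 mul1g.
rewrite (vec_psmul (erefl _) (beta1 b _)) psmulx1; congr vec; exact: ractx1.
Qed.

Lemma rep_one_r u x : j u x ** rep_one = j u x.
Proof.
case: u x => p g x; rewrite jM; apply: j_vec; first by rewrite /= resg1 mulg1.
rewrite (vec_psmul (erefl _) (beta_unitE b g cone)) psmulx1 beta_unit_one.
by congr vec; exact: ractx1.
Qed.

Lemma rep_left_representation : representation rep_left.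
Proof.
split.
- by move=> p c x y; exact: (rep_linear hj).
- exact: (rep_unit hj).
- move=> p q x y; rewrite jM; apply: j_vec; first by rewrite /= res1 mulg1.
  exact: vec_psmul (erefl _) (beta1 b y).
move=> p x y; rewrite (rep_inner hj (p := (p, 1%g))) /=.
by rewrite invg1 beta_unit1.
Qed.

Lemma rep_left_cov : cuntz_pimsner_covariant j -> cuntz_pimsner_covariant rep_left.
Proof.
move=> hc p; have [Psi hPsi aPsi] := hc (p, 1%g); exists Psi.
  exact: (iffRL (@induced_hom_bowtie _ _ _ _ _ _ b (p, 1%g) _ rep_left j Psi _) hPsi).
by move=> a /(compact_bowtie b (u := (p, 1%g))); exact: aPsi.
Qed.

Lemma rep_groupM g h : rep_group (g * h)%g = rep_group g ** rep_group h.
Proof.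
rewrite jM; apply: j_vec; first by rewrite /= resg1.
rewrite (vec_psmul (erefl _) (beta_unitE b g cone)) beta_unit_one psmul1x.
by rewrite lact1x.
Qed.

(** Both sides are the value of [j] at [beta b g x] over [(act Z g p, res Z p g)]. *)
Lemma rep_group_cov g p (x : X p) :
  rep_group g ** rep_left x = rep_left (beta b g x) ** rep_group (res Z p g).
Proof.
rewrite rep_left_group jM; apply: j_vec; first by rewrite /= mulg1.
by rewrite psmul1x lact1x.
Qed.

Lemma rep_group_isometry g : star (rep_group g) ** rep_group g = rep_one.
Proof.
rewrite (rep_inner hj) /=.
have [V [UV UK _]] := psunit_unitary X.
by rewrite (unitary_inner UV UK) /= star1 cmulx1 beta_unit_one.
Qed.

End FromBowtie.

(** * The isomorphism when [O] is unital *)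

Section UnitalTarget.
Variables (R : realType) (P : monoidType) (G : groupType) (Z : zsPair P G).
Variables (A : ucstarAlgType R) (X : productSystem P A) (b : zsSystem Z X).
Variables (O : ucstarAlgType R) (j : forall u : zsProduct Z, bowtie b u -> O).
Arguments j : clear implicits.
Hypotheses (hj : representation j) (j1 : rep_one j = cone).

Lemma rep_left_covariant :
  covariant_representation b (rep_left j) (rep_group j).
Proof.
(* An isometry with a right inverse is unitary, and its adjoint is that right inverse. *)
have UU g : rep_group j g ** rep_group j g^-1%g = cone.
  by rewrite -rep_groupM// mulgV.
have star_group g : star (rep_group j g) = rep_group j g^-1%g.
  by rewrite -[LHS]cmulx1 -(UU g) cmulA rep_group_isometry// j1 cmul1x.
split.
- exact: rep_left_representation.
- exact: j1.
- exact: j1.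
- exact: rep_groupM.
- by move=> g; rewrite rep_group_isometry.
- by move=> g; rewrite star_group.
- exact: rep_group_cov.
Qed.

Lemma bowtie_algebra_isomorphic (B : ucstarAlgType R) (psi : forall p, X p -> B)
    (U : G -> B) :
  cuntz_pimsner_algebra j -> cuntz_pimsner_bowtie_algebra b psi U ->
  star_isomorphic O B.
Proof.
move=> [_ cj gj uj] [hp cp gp up].
have [f hf fj] := uj _ _ (bowtie_representation hp) (bowtie_rep_cov hp cp).
have [h [hh hpsi hU]] := up _ _ _ rep_left_covariant (rep_left_cov cj).
(* The universal properties give no unitality; it is read off on generators, since contractivity is
   available for unital homomorphisms. *)
have f1 : f cone = cone.
  by rewrite -j1 fj /bowtie_rep /= (cov_unit hp) (cov_U1 hp) cmulx1.
have h1 : h cone = cone by rewrite -(cov_U1 hp) hU.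
have fc := star_hom_contractive hf f1.
have hc := star_hom_contractive hh h1.
have [[fL fM fS] [hL hM hS]] := (hf, hh).
exists f; split => //; exists h.
  apply: (generated_fixed (k := h \o f) gj).
  - split=> [c x y|x y|x] /=; first by rewrite fL hL.
      by rewrite fM hM.
    by rewrite fS hS.
  - by move=> x; exact: le_trans (hc _) (fc _).
  move=> _ [[p g] [x ->]] /=; rewrite fj hM hpsi hU; exact: rep_left_group.
apply: (generated_fixed (k := f \o h) gp).
- split=> [c x y|x y|x] /=; first by rewrite hL fL.
    by rewrite hM fM.
  by rewrite hS fS.
- by move=> x; exact: le_trans (fc _) (hc _).
move=> _ [[p [x ->]]|[g ->]] /=.
  by rewrite hpsi fj /bowtie_rep (cov_U1 hp) cmulx1.
by rewrite hU fj /bowtie_rep (cov_unit hp) cmul1x.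
Qed.

End UnitalTarget.

(** * Reduction to a unital [O] *)

Theorem corollary4p10 (R : realType) (P : monoidType) (G : groupType)
    (Z : zsPair P G) (A : ucstarAlgType R) (X : productSystem P A)
    (beta : zsSystem Z X)
    (O : cstarAlgType R) (j : forall u : zsProduct Z, bowtie beta u -> O)
    (B : ucstarAlgType R) (psi : forall p : P, X p -> B) (U : G -> B) :
  cuntz_pimsner_algebra j ->
  cuntz_pimsner_bowtie_algebra beta psi U ->
  star_isomorphic O B.
Proof.
move=> cpj cpB.
have [e1x ex1] :
    left_id (rep_one j) (@cmul R O) /\ right_id (rep_one j) (@cmul R O).
  apply: (generated_unit (cpa_gen cpj)) => [|_ [u [x ->]]].
    exact: rep_one_star (cpa_rep cpj).
  by rewrite (rep_one_l (cpa_rep cpj)) (rep_one_r (cpa_rep cpj)).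
(* The type of the representation depends on the algebra, so [Q] quantifies over it in order that
   [O] can be replaced by its unital version. *)
pose Q (C : cstarAlgType R) (e : C) :=
  forall k : forall u : zsProduct Z, bowtie beta u -> C,
    cuntz_pimsner_algebra k -> rep_one k = e -> star_isomorphic C B.
have QC (C : ucstarAlgType R) : Q C cone.
  move=> k cpk k1; exact: bowtie_algebra_isomorphic (cpa_rep cpk) k1 _ _ _ cpk cpB.
exact: (unital_ind QC e1x ex1 j cpj erefl).
Qed.
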